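(* Let $n\ge 4$ be an integer. (1) For every integer $\ell$ with $2\leq \ell \leq n-1$, $e_{n-1}(n,\ell,n-1)=n-1$. (2) For every integer $\ell$ with $2\leq \ell \leq n-1$, $e_{n-1}(n,\ell,n-2)=n+\ell-2$.
   Context: All graphs are finite, simple and undirected; $e(G)$ is the number of edges of $G$ and $\Delta(G)$ its maximum degree. For a graph $G$ and a nonempty set $S\subseteq V(G)$, the Steiner distance $d_G(S)$ is the minimum number of edges of a connected subgraph of $G$ whose vertex set contains $S$, with $d_G(S)=\infty$ if there is no such subgraph. For $2\le k\le n=|V(G)|$, the Steiner $k$-diameter is $sdiam_k(G)=\max\{d_G(S) : S\subseteq V(G),\ |S|=k\}$ (so it is $\infty$ if some $k$-set lies in no connected subgraph). For natural numbers $n,\ell,d$ with $\ell<n$ and $d<n$, $\mathscr{H}_k(n,\ell,d)$ is the set of all graphs $G$ of order $n$ with maximum degree exactly $\ell$ and $sdiam_k(G)\le d$, and $e_k(n,\ell,d)=\min\{e(G): G\in\mathscr{H}_k(n,\ell,d)\}$, with $e_k(n,\ell,d)=\infty$ if $\mathscr{H}_k(n,\ell,d)$ is empty. The parameter $k$ is assumed to satisfy $3\le k\le n$. *)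

(* Defs.v *)
From HB Require Import structures.
From mathcomp Require Import all_boot all_order.

Set Implicit Arguments.
Unset Strict Implicit.
Unset Printing Implicit Defensive.

Import Order.TTheory.

(* Extended naturals: [Some m] is the number m, [None] is infinity. *)
Definition enat : Type := option nat.
Definition Fin (m : nat) : enat := Some m.
Definition Infty : enat := None.

Definition enat_le (x y : enat) : bool :=
  match x, y with
  | _, None => true
  | None, Some _ => false
  | Some a, Some b => a <= b
  end.

Lemma enat_le_refl : reflexive enat_le.
Proof. by case=> /=. Qed.

Lemma enat_le_anti : antisymmetric enat_le.
Proof. by case=> [a|] [b|] //= /anti_leq ->. Qed.

Lemma enat_le_trans : transitive enat_le.
Proof. by case=> [b|] [a|] [c|] //=; apply: leq_trans. Qed.

Lemma enat_le_total : total enat_le.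
Proof. by case=> [a|] [b|] //=; apply: leq_total. Qed.

Fact enat_display : Order.disp_t. Proof. exact: Order.Disp tt tt. Qed.

HB.instance Definition _ := Choice.copy enat (option nat).
HB.instance Definition _ := Order.Le_isPOrder.Build enat_display enat
  enat_le_refl enat_le_anti enat_le_trans.
HB.instance Definition _ := Order.POrder_isTotal.Build enat_display enat
  enat_le_total.

Section Graphs.
Variable V : finType.

Record sgraph := SGraph {
  edges : {set {set V}};
  _ : [forall e in edges, #|e| == 2]
}.

HB.instance Definition _ := [isSub for edges].
HB.instance Definition _ := [Finite of sgraph by <:].

Definition num_edges (G : sgraph) : nat := #|edges G|.

Definition degree (G : sgraph) (v : V) : nat :=
  #|[set u | [set u; v] \in edges G]|.

Definition max_degree (G : sgraph) : nat := \max_(v : V) degree G v.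

(* A subgraph is a pair H of a vertex set H.1 and an edge set H.2. *)
Definition is_subgraph (G : sgraph) (H : {set V} * {set {set V}}) : bool :=
  (H.2 \subset edges G) && [forall e in H.2, e \subset H.1].

Definition is_connected (H : {set V} * {set {set V}}) : bool :=
  (H.1 != set0) &&
  [forall u in H.1, forall v in H.1,
     connect (fun x y => [set x; y] \in H.2) u v].

Definition steiner_dist (G : sgraph) (S : {set V}) : enat :=
  \big[Order.min/Infty]_(H : {set V} * {set {set V}}
         | [&& is_subgraph G H, is_connected H & S \subset H.1])
     Fin #|H.2|.

Definition sdiam (k : nat) (G : sgraph) : enat :=
  \big[Order.max/Fin 0]_(S : {set V} | #|S| == k) steiner_dist G S.

End Graphs.

(* Graphs of order n are taken on the vertex set 'I_n. *)
Definition Hset (k n l d : nat) : {set sgraph 'I_n} :=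
  [set G | (max_degree G == l) && (sdiam k G <= Fin d)%O].

Definition emin (k n l d : nat) : enat :=
  \big[Order.min/Infty]_(G in Hset k n l d) Fin (num_edges G).

(* Main.v *)
(* With k = n - 1, a graph G satisfies sdiam <= n - 1 iff it is connected, and
   sdiam <= n - 2 iff G - v is connected for every vertex v: a connected subgraph
   with at most n - 2 edges has at most n - 1 vertices, so it spans exactly the
   chosen (n - 1)-set. The first condition forces n - 1 edges. Under the second,
   if v has degree l, then G - v has at least n - 2 edges, to which the l edges
   at v are added. Equality holds for a broom (a star with l leaves, one of them
   prolonged by a path) in the first case. In the second it holds for a
   Hamiltonian cycle with l - 2 chords at one vertex: deleting any vertex leaves
   a path of the cycle. *)
Require Import Defs.
From mathcomp Require Import all_boot all_order.
From mathcomp Require Import zify.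

Set Implicit Arguments.
Unset Strict Implicit.
Unset Printing Implicit Defensive.

(** * Connectedness, Steiner distance and their bounds *)

Definition adj {V : finType} (E : {set {set V}}) : rel V :=
  fun x y => [set x; y] \in E.

Lemma adj_sym {V : finType} (E : {set {set V}}) : symmetric (adj E).
Proof. by move=> x y; rewrite /adj setUC. Qed.

Lemma is_connectedI {V : finType} (A : {set V}) (E : {set {set V}}) (r : V) :
  r \in A -> (forall v, v \in A -> connect (adj E) r v) -> is_connected (A, E).
Proof.
move=> rA rP; apply/andP; split; first by apply/set0Pn; exists r.
apply/forall_inP => u uA; apply/forall_inP => v vA.
apply: (@connect_trans _ (adj E) r); last exact: rP.
by rewrite (sym_connect_sym (adj_sym E)) rP.
Qed.

Lemma is_connected_connect {V : finType} (H : {set V} * {set {set V}}) (u v : V) :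
  is_connected H -> u \in H.1 -> v \in H.1 -> connect (adj H.2) u v.
Proof. by case/andP=> _ /forall_inP HP uH vH; move/forall_inP: (HP u uH); apply. Qed.

(* A maximal vertex set containing [r] and spanning at least #|X| - 1 edges is
   closed under adjacency. *)
Lemma is_connected_card {V : finType} (H : {set V} * {set {set V}}) :
  is_connected H -> #|H.1| <= #|H.2|.+1.
Proof.
move=> cH; have /andP[/set0Pn[r rH] _] := cH.
pose spanned (X : {set V}) := [set e in H.2 | e \subset X].
pose P (X : {set V}) := (r \in X) && (#|X| <= #|spanned X|.+1).
have Pr : P [set r] by rewrite /P set11 cards1.
have [X /maxsetP[/andP[rX cX] maxX] _] := maxset_exists Pr.
have clX : closed (adj H.2) X.
  apply: (intro_closed (sym_connect_sym (adj_sym H.2))) => x y xy xX.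
  (* Adding an outside neighbour [y] costs one vertex and gains at least the edge [[set x; y]], so
     the inequality in [P] survives, against maximality. *)
  apply: contraT => yX; suff /maxX : P (y |: X).
    by move=> /(_ (subsetUr _ _)) eX; case/negP: yX; rewrite -eX setU11.
  rewrite /P setU1r // cardsU1 yX add1n ltnS (leq_trans cX) //.
  apply/proper_card/properP; split.
    apply/subsetP => e; rewrite !inE => /andP[-> eX] /=.
    exact: subset_trans eX (subsetUr _ _).
  exists [set x; y]; rewrite inE ?negb_and.
    by rewrite -/(adj _ x y) xy subUset !sub1set setU1r ?setU11.
  by rewrite subUset !sub1set (negPf yX) andbF orbT.
have sHX : H.1 \subset X.
  apply/subsetP => v vH.
  by rewrite -(closed_connect clX (is_connected_connect cH rH vH)).
apply: leq_trans (subset_leq_card sHX) (leq_trans cX _).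
by rewrite ltnS subset_leq_card //; apply/subsetP => e; rewrite inE => /andP[].
Qed.

(** The empty minimum is [Infty], above every [Fin d], so a finite bound can only come from an
    actual subgraph. *)
Lemma steiner_dist_leP {V : finType} (G : sgraph V) (S : {set V}) (d : nat) :
  (steiner_dist G S <= Fin d)%O <->
  exists H : {set V} * {set {set V}},
    [/\ is_subgraph G H, is_connected H, S \subset H.1 & #|H.2| <= d].
Proof.
split=> [le_d|[H [sH cH SH leH]]].
  suff /existsP[H /and4P[? ? ? ?]] : [exists H : {set V} * {set {set V}},
      [&& is_subgraph G H, is_connected H, S \subset H.1 & #|H.2| <= d]].
    by exists H; split.
  move: le_d; apply: contraLR => /existsPn noH.
  rewrite -Order.TotalTheory.ltNge; apply/Order.TotalTheory.bigmin_gtP.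
  split=> // H /and3P[sH cH SH]; have := noH H; rewrite sH cH SH /=.
  by rewrite Order.TotalTheory.ltNge.
by apply: (Order.TotalTheory.bigmin_inf H); rewrite ?sH ?cH.
Qed.

Lemma sdiam_leP {V : finType} (k d : nat) (G : sgraph V) :
  (sdiam k G <= Fin d)%O <->
  forall S : {set V}, #|S| = k -> (steiner_dist G S <= Fin d)%O.
Proof.
split=> [/Order.TotalTheory.bigmax_leP[_ le_d] S /eqP|le_d]; first exact: le_d.
by apply/Order.TotalTheory.bigmax_leP; split=> // S /eqP; apply: le_d.
Qed.

Lemma emin_eq (k n l d m : nat) (G : sgraph 'I_n) :
  G \in Hset k n l d -> num_edges G <= m ->
  (forall G', G' \in Hset k n l d -> m <= num_edges G') ->
  emin k n l d = Fin m.
Proof.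
move=> GH leG geG; apply: Order.POrderTheory.le_anti; apply/andP; split.
  exact: (Order.TotalTheory.bigmin_inf G).
exact: Order.POrderTheory.le_bigmin.
Qed.

(** * Lower bounds on the number of edges *)

Lemma edge_card {V : finType} (G : sgraph V) (e : {set V}) :
  e \in edges G -> #|e| = 2.
Proof. by case: G => E /= /forall_inP EP /EP/eqP. Qed.

(** Neighbours [u] correspond to edges [[set u; v]]; the map is injective because an edge has two
    distinct ends. *)
Lemma card_incident {V : finType} (G : sgraph V) (v : V) :
  #|[set e in edges G | v \in e]| = degree G v.
Proof.
rewrite /degree -(@card_in_imset _ _ (fun u => [set u; v])) => [|u w].
  apply: eq_card => e; rewrite inE; apply/andP/imsetP => [[eG ve]|[u]].
    have /eqP/cards2P[x [y [xy def_e]]] := edge_card eG.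
    move: ve; rewrite def_e !inE => /orP[]/eqP v_; [exists y|exists x];
      by rewrite ?inE v_ 1?setUC -?def_e // setUC -?def_e.
  by rewrite inE => uv ->; rewrite uv !inE eqxx orbT.
rewrite !inE => uv wv e_uw; have := edge_card uv; rewrite cards2.
have : u \in [set w; v] by rewrite -e_uw !inE eqxx.
by rewrite !inE => /orP[/eqP//|/eqP->]; rewrite eqxx.
Qed.

(** Any two vertices lie in the complement of some third vertex [z], an (n - 1)-set; a connected
    subgraph containing that set joins them. *)
Lemma Hset_connected (n l d : nat) (G : sgraph 'I_n) :
  2 < n -> G \in Hset (n - 1) n l d -> is_connected ([set: 'I_n], edges G).
Proof.
move=> n3; rewrite inE => /andP[_ /sdiam_leP le_d].
have r : 'I_n by exists 0; lia.
apply: (@is_connectedI _ _ _ r) => // v _.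
have [z] : exists z, z \notin [set r; v].
  apply/existsP; rewrite -[X in is_true X]negbK negb_exists; apply/negP.
  move=> /forallP all_rv; suff : n <= 2 by lia.
  rewrite -{1}(card_ord n) -cardsT; apply: leq_trans (_ : #|[set r; v]| <= 2).
    by apply/subset_leq_card/subsetP => x _; have := all_rv x; rewrite negbK.
  by rewrite cards2; case: eqP.
rewrite !inE negb_or => /andP[zr zv].
have /le_d/steiner_dist_leP[H [/andP[sH _] cH SH _]] : #|[set~ z]| = n - 1.
  by rewrite cardsC1 card_ord subn1.
have HP x : z != x -> x \in H.1.
  by move=> zx; apply: (subsetP SH); rewrite !inE eq_sym.
apply: connect_sub (is_connected_connect cH (HP _ zr) (HP _ zv)) => x y xy.
by apply: connect1; apply: (subsetP sH).
Qed.

Lemma Hset_connected_edges (n l d : nat) (G : sgraph 'I_n) :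
  2 < n -> G \in Hset (n - 1) n l d -> n - 1 <= num_edges G.
Proof.
move=> n3 /(Hset_connected n3)/is_connected_card /=.
by rewrite cardsT card_ord subn1 -subn1 leq_subLR add1n.
Qed.

(* Deleting a vertex of maximum degree [l] removes [l] edges and leaves a
   connected graph, which has at least [n - 2] edges. *)
Lemma Hset_biconnected_edges (n l : nat) (G : sgraph 'I_n) :
  2 < n -> G \in Hset (n - 1) n l (n - 2) -> n + l - 2 <= num_edges G.
Proof.
move=> n3; rewrite inE => /andP[/eqP<- /sdiam_leP le_d].
have [|v] := eq_bigmax (degree G); first by rewrite card_ord; lia.
rewrite -/(max_degree G) => ->.
have /le_d/steiner_dist_leP[H [/andP[sH /forall_inP HP] cH SH leH]] :
    #|[set~ v]| = n - 1 by rewrite cardsC1 card_ord subn1.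
have := is_connected_card cH => cardH.
(* If [H] contained [v] it would span all [n] vertices, and connectedness would force n - 1 edges,
   one more than allowed. *)
have vH : v \notin H.1.
  apply: contraTN leH => vH; suff : n <= #|H.1| by lia.
  rewrite -{1}(card_ord n) -cardsT subset_leq_card //; apply/subsetP => x _.
  by have [->//|xv] := eqVneq x v; apply: (subsetP SH); rewrite !inE.
have geH : n - 1 <= #|H.1|.
  by have := subset_leq_card SH; rewrite cardsC1 card_ord; lia.
have disj : [disjoint H.2 & [set e in edges G | v \in e]].
  rewrite disjoint_subset; apply/subsetP => e /HP/subsetP eH.
  by rewrite !inE negb_and; apply/orP; right; apply: contra vH => /eH.
have : #|H.2 :|: [set e in edges G | v \in e]| <= num_edges G.
  rewrite subset_leq_card // subUset sH.
  by apply/subsetP => e; rewrite inE => /andP[].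
rewrite cardsU disjoint_setI0 // cards0 card_incident; lia.
Qed.

(** * Graphs made of a hub and a path *)

(** Lets sets of ordinals, or of pairs of ordinals, be counted against explicit lists of natural
    numbers. *)
Lemma card_leq_size {T : finType} {U : eqType} (f : T -> U) (A : {set T})
    (s : seq U) :
  injective f -> (forall x, x \in A -> f x \in s) -> #|A| <= size s.
Proof.
move=> f_inj fA; rewrite cardE -(size_map f); apply: uniq_leq_size.
  by rewrite map_inj_uniq // enum_uniq.
by move=> _ /mapP[x xA ->]; apply: fA; rewrite mem_enum in xA.
Qed.

Lemma size_leq_card {T : finType} {U : eqType} (f : T -> U) (A : {set T})
    (s : seq U) :
  uniq s -> (forall y, y \in s -> exists2 x, x \in A & f x = y) -> size s <= #|A|.
Proof.
move=> s_uniq fA; rewrite cardE -(size_map f); apply: uniq_leq_size => // y.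
by move=> /fA[x xA <-]; apply: map_f; rewrite mem_enum.
Qed.

(** The relation may be asymmetric: listing each edge in one orientation makes the number of related
    pairs a sharp bound on the edge count. *)
Definition rel_edges {V : finType} (r : rel V) : {set {set V}} :=
  [set [set p.1; p.2] | p : V * V & (p.1 != p.2) && r p.1 p.2].

Lemma rel_edges_card {V : finType} (r : rel V) :
  [forall e in rel_edges r, #|e| == 2].
Proof.
apply/forall_inP => e /imsetP[p]; rewrite inE => /andP[xy _] ->.
by rewrite cards2 xy.
Qed.

Definition rel_graph {V : finType} (r : rel V) : sgraph V :=
  SGraph (rel_edges_card r).

Lemma mem_rel_graph {V : finType} (r : rel V) (x y : V) :
  ([set x; y] \in edges (rel_graph r)) = (x != y) && (r x y || r y x).
Proof.
apply/imsetP/andP => [[[a b] /=]|[xy rxy]].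
  rewrite inE /= => /andP[ab rab] def_xy.
  have xy : x != y.
    by have := cards2 a b; rewrite -def_xy cards2 ab; case: (x != y).
  have : x \in [set a; b] by rewrite -def_xy set21.
  have : y \in [set a; b] by rewrite -def_xy set22.
  rewrite !inE => /orP[]/eqP def_y /orP[]/eqP def_x; move: xy;
    by rewrite def_x def_y ?eqxx //= rab ?orbT.
case/orP: rxy => rxy; first by exists (x, y); rewrite // inE xy.
by exists (y, x); rewrite /= 1?setUC // inE /= eq_sym xy.
Qed.

Lemma num_edges_rel_graph {V : finType} (r : rel V) :
  num_edges (rel_graph r) <= #|[set p : V * V | r p.1 p.2]|.
Proof.
apply: leq_trans (leq_imset_card _ _) _; apply: subset_leq_card.
by apply/subsetP => p; rewrite !inE => /andP[].
Qed.

(* The hub 0 is joined to the elements of [N], and a path runs from [a] to the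
   last vertex. *)
Definition hub_rel (N : seq nat) (a : nat) : rel nat :=
  fun x y => (x == 0) && (y \in N) || (a <= x) && (y == x.+1).

Definition hub_graph (n : nat) (N : seq nat) (a : nat) : sgraph 'I_n.+1 :=
  rel_graph (fun x y : 'I_n.+1 => hub_rel N a x y).

Lemma mem_hub_graph (n : nat) (N : seq nat) (a : nat) (x y : 'I_n.+1) :
  ([set x; y] \in edges (hub_graph n N a)) =
  (x != y :> nat) && (hub_rel N a x y || hub_rel N a y x).
Proof. exact: mem_rel_graph. Qed.

Lemma num_edges_hub_graph (n : nat) (N : seq nat) (a : nat) :
  num_edges (hub_graph n N a) <= size N + (n - a).
Proof.
apply: leq_trans (num_edges_rel_graph _) _.
pose s := [seq (0, y) | y <- N] ++ [seq (x, x.+1) | x <- iota a (n - a)].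
have -> : size N + (n - a) = size s by rewrite size_cat !size_map size_iota.
apply: (@card_leq_size _ _ (fun p => (val p.1, val p.2))) => [[x y] [x' y'] /=|].
  by case=> /val_inj-> /val_inj->.
case=> x y; rewrite inE /= mem_cat => /orP[] /andP[].
  by move=> /eqP-> yN; rewrite map_f.
move=> ax /eqP def_y; have := ltn_ord y; rewrite def_y => xn.
rewrite orbC (map_f (fun x => (x, x.+1))) // mem_iota; lia.
Qed.

(** Since [a] is positive, the path avoids the hub, whose neighbours are then exactly the elements
    of [N]. *)
Lemma degree_hub0 (n : nat) (N : seq nat) (a : nat) :
  0 < a -> uniq N -> (forall y, y \in N -> 0 < y <= n) ->
  degree (hub_graph n N a) ord0 = size N.
Proof.
move=> a0 uN N_n; apply/eqP; rewrite eqn_leq; apply/andP; split.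
  apply: (card_leq_size val_inj) => u; rewrite inE mem_hub_graph /hub_rel /=.
  case: (boolP (0 \in N)) => [/N_n//|_].
  case: (boolP (val u \in N)) => //= _; lia.
apply: (@size_leq_card _ _ val) => // y yN; have /andP[y0 yn] := N_n y yN.
exists (inord y); last by rewrite /= inordK.
rewrite inE mem_hub_graph /hub_rel inordK //=.
by rewrite yN orbT -lt0n y0.
Qed.

Lemma degree_hub_leq (n : nat) (N : seq nat) (a : nat) (v : 'I_n.+1)
    (s : seq nat) :
  (forall u, u <= n -> u != v :> nat -> hub_rel N a u v || hub_rel N a v u ->
     u \in s) ->
  degree (hub_graph n N a) v <= size s.
Proof.
move=> sP; apply: (card_leq_size val_inj) => u.
rewrite inE mem_hub_graph => /andP[uv]; apply: sP => //.
by rewrite -ltnS.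
Qed.

Lemma max_degreeP {V : finType} (G : sgraph V) (v : V) (l : nat) :
  degree G v = l -> (forall u, degree G u <= l) -> max_degree G = l.
Proof.
move=> <- le_l; apply/eqP; rewrite eqn_leq; apply/andP; split.
  by apply/bigmax_leqP => u _.
exact: leq_bigmax.
Qed.

(** * The extremal graphs *)

(** The broom has leaves 1, ..., l, with the path l, l + 1, ..., n attached. The whole graph, with
    at most n edges, serves as Steiner subgraph for every [S]. *)
Lemma broom_Hset (n l : nat) :
  2 <= l <= n -> hub_graph n (iota 1 l) l \in Hset n n.+1 l n.
Proof.
move=> /andP[l2 ln]; rewrite inE; apply/andP; split.
  apply/eqP/(@max_degreeP _ _ ord0) => [|v].
    rewrite degree_hub0 ?size_iota ?iota_uniq //; first lia.
    by move=> y; rewrite mem_iota; lia.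
  have [v0|v0] := eqVneq (v : nat) 0.
    apply: leq_trans (_ : size (iota 1 l) <= l); last by rewrite size_iota.
    apply: degree_hub_leq => u un; rewrite /hub_rel !mem_iota; lia.
  (* Off the hub, the only possible neighbours are the one towards the hub and the next path vertex:
     at most two, hence at most [l]. *)
  apply: leq_trans (_ : size [:: if v <= l then 0 else v.-1; v.+1] <= l) => //.
  apply: degree_hub_leq => u un; rewrite /hub_rel !mem_iota !inE.
  case: ifP; lia.
apply/sdiam_leP => S _; apply/steiner_dist_leP.
exists (setT, edges (hub_graph n (iota 1 l) l)); split=> //.
- by rewrite /is_subgraph subxx; apply/forall_inP => e _; apply: subsetT.
- apply: (@is_connectedI _ _ _ ord0) => // v _.
  have [k] := ubnP (v : nat); elim: k v => // k IHk v vk.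
  have [v0|v0] := eqVneq (v : nat) 0.
    by have -> : v = ord0 by [apply: val_inj].
  have [vl|lv] := leqP v l.
    apply: connect1; rewrite /adj mem_hub_graph /hub_rel mem_iota /=; lia.
  have vn := ltn_ord v.
  have vk1 : (inord v.-1 : 'I_n.+1) < k by rewrite inordK; lia.
  apply: connect_trans (IHk _ vk1) (connect1 _).
  rewrite /adj mem_hub_graph /hub_rel !mem_iota inordK; lia.
- exact: subsetT.
- apply: leq_trans (num_edges_hub_graph _ _ _) _.
  rewrite size_iota; lia.
Qed.

Lemma hamiltonian_steiner_dist (n : nat) (G : sgraph 'I_n.+1)
    (S : {set 'I_n.+1}) :
  (forall x, [set inord (x %% n.+1); inord (x.+1 %% n.+1)] \in edges G) ->
  0 < n -> #|S| = n -> (steiner_dist G S <= Fin n.-1)%O.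
Proof.
move=> ham n0 cS.
have [v def_S] : exists v, S = [set~ v].
  have /eqP/cards1P[v def_v] : #|~: S| = 1.
    by have := cardsC S; rewrite card_ord cS; lia.
  by exists v; rewrite -def_v setCK.
(* [c j] is the vertex [j] steps after the omitted [v] on the cycle; [S] consists of [c 1], ...,
   [c n]. *)
pose c j : 'I_n.+1 := inord ((v + j) %% n.+1).
have val_c j : val (c j) = (v + j) %% n.+1 by rewrite /= inordK // ltn_pmod.
have c_neq j : 0 < j <= n -> c j != v.
  move=> jn; apply/eqP => /(congr1 val); rewrite val_c => e.
  have : v + j == v + 0 %[mod n.+1].
    by rewrite addn0 e modn_small // ltn_ord.
  rewrite eqn_modDl mod0n modn_small; lia.
have c_onto u : u != v -> exists2 j, j < n & u = c j.+1.
  move=> uv; have un := ltn_ord u; have vn := ltn_ord v.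
  have {}uv : (u != v :> nat) := uv.
  have [vu|uv'] := ltnP v u.
    exists (u - v).-1; first lia.
    by apply: val_inj; rewrite val_c modn_small /=; lia.
  (* Here [u] precedes [v], so the walk from [v] wraps around once. *)
  exists (u + n - v); first lia.
  apply: val_inj; rewrite val_c (_ : v + _ = u + n.+1); last lia.
  by rewrite modnDr modn_small.
(* The cycle without [v] is a path on [n] vertices, with n - 1 edges. *)
pose F := [set [set c j.+1; c j.+2] | j : 'I_n.-1].
apply/steiner_dist_leP; exists (S, F); rewrite def_S; split=> //=.
- rewrite /is_subgraph /=; apply/andP; split.
    apply/subsetP => _ /imsetP[j _ ->].
    by rewrite /c (addnS v j.+1); apply: ham.
  apply/forall_inP => _ /imsetP[j _ ->]; have := ltn_ord j => jn.
  by rewrite subUset !sub1set !inE !c_neq //; lia.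
- apply: (@is_connectedI _ _ _ (c 1)) => [|u]; rewrite !inE; first exact: c_neq.
  case/c_onto => j jn ->; elim: j jn => // j IHj jn.
  apply: connect_trans (IHj (ltnW jn)) (connect1 _).
  have jn' : j < n.-1 by lia.
  by apply/imsetP; exists (Ordinal jn').
- by apply: leq_trans (leq_imset_card _ _) _; rewrite card_ord.
Qed.

(** The path 1, ..., n is closed into a Hamiltonian cycle by the edges from 0 to 1 and [n]; the
    spokes to 2, ..., l - 1 are the chords. *)
Lemma fan_Hset (n l : nat) :
  2 <= l <= n ->
  hub_graph n (rcons (iota 1 l.-1) n) 1 \in Hset n n.+1 l n.-1.
Proof.
move=> /andP[l2 ln]; set N := rcons _ _; set G := hub_graph _ _ _.
have memN y : (y \in N) = (y == n) || (0 < y < l).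
  by rewrite mem_rcons inE mem_iota; lia.
have sizeN : size N = l by rewrite size_rcons size_iota; lia.
rewrite inE; apply/andP; split.
  apply/eqP/(@max_degreeP _ _ ord0) => [|v].
    rewrite degree_hub0 ?sizeN // => [|y]; last by rewrite memN; lia.
    rewrite rcons_uniq iota_uniq mem_iota; lia.
  have [v0|v0] := eqVneq (v : nat) 0.
    rewrite -sizeN; apply: degree_hub_leq => u un.
    rewrite /hub_rel !memN; lia.
  have [l3|l_2] := ltnP 2 l.
    apply: leq_trans (_ : size [:: 0; v.-1; v.+1] <= l) => //.
    apply: degree_hub_leq => u un; rewrite /hub_rel !memN !inE; lia.
  (* For [l = 2] there are no chords, and a list of three candidates would be too long: these are
     the two cycle neighbours, the successor of [n] being 0. *)
  pose s := [:: v.-1; if v == n :> nat then 0 else v.+1].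
  apply: leq_trans (_ : size s <= l) => //.
  apply: degree_hub_leq => u un; rewrite /hub_rel !memN !inE.
  case: ifP; lia.
apply/sdiam_leP => S cS; apply: hamiltonian_steiner_dist => // [x|]; last lia.
rewrite mem_hub_graph /hub_rel !memN !inordK ?ltn_pmod //.
have xn : x %% n.+1 <= n by rewrite -ltnS ltn_pmod.
have -> : x.+1 %% n.+1 = if x %% n.+1 == n then 0 else (x %% n.+1).+1.
  rewrite -addn1 -modnDml addn1; case: eqP => [->|ne]; first exact: modnn.
  by rewrite modn_small //; lia.
case: ifP; lia.
Qed.

Unset Implicit Arguments.

Theorem theorem2p1 (n : nat) (hn : 4 <= n) :
  (forall l : nat, 2 <= l <= n - 1 -> emin (n - 1) n l (n - 1) = Fin (n - 1)) /\
  (forall l : nat, 2 <= l <= n - 1 ->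
     emin (n - 1) n l (n - 2) = Fin (n + l - 2)).
Proof.
have n3 : 2 < n by apply: leq_trans hn.
split=> l ln.
  move=> {hn}; case: n n3 ln => // n n3; rewrite subn1 /= => ln.
  apply: emin_eq (broom_Hset ln) _ _ => [|G GH].
    (* There are [l] spokes and [n - l] path edges. *)
    apply: leq_trans (num_edges_hub_graph _ _ _) _; rewrite size_iota; lia.
  by have := @Hset_connected_edges n.+1 l n G n3; rewrite subn1; apply.
move=> {hn}; case: n n3 ln => // n n3; rewrite subn1 /= => ln.
rewrite (_ : n.+1 - 2 = n.-1); last by rewrite subSS subn1.
apply: emin_eq (fan_Hset ln) _ _ => [|G GH].
  (* There are [l] spokes and [n - 1] path edges, the order now being [n.+1]. *)
  apply: leq_trans (num_edges_hub_graph _ _ _) _.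
  by rewrite size_rcons size_iota; lia.
by have := @Hset_biconnected_edges n.+1 l G n3; rewrite subn1 subSS subn1; apply.
Qed.
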